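(* Let $q$ be a prime power and let $n\in\mathbb{N}=\{0,1,2,\ldots\}$. Then the number $c(C_q(n))$ of spanning trees of the graph $C_q(n)$ is $$c(C_q(n)) = F_q(n,0,1)\,\prod_{k=1}^{\lfloor n/2\rfloor} F_q(n,k,k)^{\binom{n}{k}_q-\binom{n}{k-1}_q},$$ where $F_q(n,0,1)=[1]_q[2]_q\cdots[n]_q$.
   Context: For a graph $G$, $c(G)$ denotes the number of spanning trees of $G$. For a prime power $q$, $B_q(n)$ denotes the set of all subspaces of an $n$-dimensional vector space over the finite field $\mathbb{F}_q$. $C_q(n)$ is the graph with vertex set $B_q(n)$ in which subspaces $X,Y$ are joined by an edge iff ($X\subseteq Y$ or $Y\subseteq X$) and $|\dim X-\dim Y|=1$. The $q$-binomial coefficient $\binom{n}{k}_q$ is the number of $k$-dimensional subspaces in $B_q(n)$. For $k\in\mathbb{N}$, $[k]_q=1+q+q^2+\cdots+q^{k-1}$ (so $[0]_q=0$). For $k,n\in\mathbb{N}$ with $k\le n/2$, the polynomials $F_q(n,k,j)$ in $q$, for $k\le j\le n-k+1$, are defined recursively by $$F_q(n,k,n-k+1)=1,\qquad F_q(n,k,n-k)=[k]_q+[n-k]_q,$$ and, for $k\le j<n-k$, $$F_q(n,k,j)=([j]_q+[n-j]_q)\,F_q(n,k,j+1)-q^k[j+1-k]_q[n-k-j]_q\,F_q(n,k,j+2).$$ *)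

(* Defs.v *)
From HB Require Import structures.
From mathcomp Require Import all_boot all_order all_algebra.

Set Implicit Arguments.
Unset Strict Implicit.
Unset Printing Implicit Defensive.

Import Order.TTheory GRing.Theory Num.Theory.

Local Open Scope ring_scope.

Section SpanningTrees.
Variable T : finType.
Implicit Types (e : rel T) (S : {set {set T}}).

(* A simple graph is a symmetric irreflexive relation e; its edges are the
   unordered pairs [set x; y] with e x y. *)
Definition graph_edges e : {set {set T}} :=
  [set [set u.1; u.2] | u : T * T & e u.1 u.2].

Definition edge_adj S : rel T := [rel x y | [set x; y] \in S].

Definition edge_connected S : bool :=
  [forall x, forall y, connect (edge_adj S) x y].

(* A duplicate-free sequence has at most #|T| terms, so it is enough to
   quantify over tuples of length at most #|T|; see edge_acyclicP. *)
Definition edge_acyclic S : bool :=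
  [forall m : 'I_#|T|.+1, forall c : m.-tuple T,
     (2 < m)%N ==> ~~ (cycle (edge_adj S) c && uniq c)].

Lemma edge_acyclicP S :
  reflect (forall c : seq T, (2 < size c)%N -> ~ ucycle (edge_adj S) c)
          (edge_acyclic S).
Proof.
apply: (iffP forallP) => [acyc c c_gt2 /andP[cyc_c uniq_c] | acyc m].
  have lt_c : (size c < #|T|.+1)%N by rewrite ltnS -(card_uniqP uniq_c) max_card.
  have /forallP/(_ (in_tuple c)) := acyc (Ordinal lt_c).
  by rewrite c_gt2 cyc_c uniq_c.
apply/forallP=> c; apply/implyP=> m_gt2; apply/negP.
by apply: acyc; rewrite size_tuple.
Qed.

(* A spanning tree of e on the vertex set T is identified with its edge set. *)
Definition spanning_trees e : {set {set {set T}}} :=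
  [set S : {set {set T}} |
     [&& S \subset graph_edges e, edge_connected S & edge_acyclic S]].

Definition nb_spanning_trees e : nat := #|spanning_trees e|.

End SpanningTrees.

(* {vspace V} is a subtype of matrices, hence finite over a finite field. *)
Section FiniteSubspaces.
Import VectorInternalTheory.
Variables (F : finFieldType) (V : vectType F).

HB.instance Definition _ := [Countable of {vspace V} by <:].
HB.instance Definition _ := [Finite of {vspace V} by <:].

End FiniteSubspaces.

Definition subspace_graph (F : finFieldType) (V : vectType F) :
    rel {vspace V} :=
  fun X Y => ((X <= Y)%VS || (Y <= X)%VS)
             && (`|(\dim X)%:Z - (\dim Y)%:Z| == 1).

Lemma subspace_graph_sym (F : finFieldType) (V : vectType F) :
  symmetric (@subspace_graph F V).
Proof. by move=> X Y; rewrite /subspace_graph orbC distrC. Qed.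

Lemma subspace_graph_irr (F : finFieldType) (V : vectType F) :
  irreflexive (@subspace_graph F V).
Proof. by move=> X; rewrite /subspace_graph subrr normr0 andbF. Qed.

Definition qbinom (F : finFieldType) (V : vectType F) (k : nat) : nat :=
  #|[set U : {vspace V} | \dim U == k]|.

Section FPolynomials.
(* The polynomials in q are given by their values at q in an arbitrary
   commutative ring; q = 'X in {poly int} yields the polynomials themselves. *)
Variables (R : comNzRingType) (q : R).

Definition qint (k : nat) : R := \sum_(i < k) q ^+ i.

(* Fpoly_rec n k m is F_q(n,k,j) for j = n - k + 1 - m; in the clause m.+2
   this j is n - k - 1 - m. *)
Fixpoint Fpoly_rec (n k m : nat) : R :=
  match m with
  | 0 => 1
  | m1.+1 =>
    match m1 with
    | 0 => qint k + qint (n - k)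
    | m2.+1 =>
      let j := (n - k - 1 - m2)%N in
      (qint j + qint (n - j)) * Fpoly_rec n k m1
      - q ^+ k * qint (j + 1 - k) * qint (n - k - j) * Fpoly_rec n k m2
    end
  end.

(* Meaningful for k <= n / 2 and k <= j <= n - k + 1. *)
Definition Fpoly (n k j : nat) : R := Fpoly_rec n k (n - k + 1 - j).

Lemma Fpoly_last n k : Fpoly n k (n - k + 1) = 1.
Proof. by rewrite /Fpoly subnn. Qed.

Lemma Fpoly_penult n k : Fpoly n k (n - k) = qint k + qint (n - k).
Proof. by rewrite /Fpoly addnC addnK. Qed.

Lemma Fpoly_step n k j : (j < n - k)%N ->
  Fpoly n k j =
    (qint j + qint (n - j)) * Fpoly n k (j + 1)
    - q ^+ k * qint (j + 1 - k) * qint (n - k - j) * Fpoly n k (j + 2).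
Proof.
move=> lt_j; rewrite /Fpoly.
have [m def_m] : exists m, (n - k = j + m.+1)%N.
  by exists (n - k - j.+1)%N; rewrite addnS -addSn subnKC.
have -> : (n - k + 1 - j = m.+2)%N by rewrite def_m -addnA addKn addn1.
have -> : (n - k + 1 - (j + 1) = m.+1)%N by rewrite subnDr def_m addKn.
have -> : (n - k + 1 - (j + 2) = m)%N.
  by rewrite addn2 addn1 subSS def_m addnS -addSn addKn.
have def_j : (n - k - 1 - m = j)%N by rewrite def_m addnS subn1 addnK.
by rewrite /= def_j.
Qed.

End FPolynomials.

(* Main.v *)
Require Import Defs.
From HB Require Import structures.
From mathcomp Require Import all_boot all_order all_fingroup all_algebra.
From mathcomp Require Import finfield.
From mathcomp Require Import zify ring lra.
Set Implicit Arguments.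
Unset Strict Implicit.
Unset Printing Implicit Defensive.
Import Order.TTheory GRing.Theory Num.Theory.
Local Open Scope ring_scope.

(** By the matrix-tree theorem, the number of spanning trees is the determinant
    of the Laplacian of the graph with the row and the column of the zero
    subspace removed.  The whole proof is a computation of this determinant.

    Let U be the operator sending a subspace to the sum of the subspaces that
    cover it, and D its transpose.  A subspace of dimension j has [j] lower and
    [n-j] upper covers, and two distinct subspaces have as many common upper
    covers as common lower ones; hence D U - U D acts on the subspaces of
    dimension j as the scalar [n-j] - [j].  With

      kappa_k = (q^(n+1-k) + q^k) / (q-1)^2,

    this scalar is kappa_j - kappa_(j+1), so that the operator

      C = U D + kappa_j = D U + kappa_(j+1)   (in dimension j)

    commutes with U and D: it is a Casimir operator.  The Laplacian being
    A - U - D with A scalar in each dimension, it is block tridiagonal and the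
    products D U of its off-diagonal blocks are the polynomials
    C - kappa_(j+1).  Gaussian elimination from the top dimension downwards
    therefore yields pivots that are quotients K_j(C) / K_(j+1)(C) of
    continuants, which satisfy the recurrence defining F_q
    ([det_tridiag_from_rec]).

    It remains to know the determinant of a polynomial in C on the subspaces of
    dimension j.  There C - kappa_j is U D, while it is D U in dimension j-1, so
    the identity det (1 + A B) = det (1 + B A) compares the two dimensions
    ([level_det_rec]): going from j-1 to j multiplies det p(C) by
    p(kappa_j)^(N_j - N_(j-1)), where N_j counts the subspaces of dimension j.
    In other words C has eigenvalue kappa_j with multiplicity N_j - N_(j-1).
    The telescoping product of the pivots is then

      K_1(kappa_0) * prod_(1 <= j <= n) K_j(kappa_j)^(N_j - N_(j-1)),

    with exponents that become negative past the middle dimension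
    ([det_tridiag_from1]).

    Since kappa_(n+1-k) = kappa_k and N_(n-k) = N_k, the factors k and n+1-k
    have opposite exponents, and only the quotient K_k / K_(n+1-k) at kappa_k
    survives.  It equals F_q(n,k,k), because the coefficient
    kappa_k - kappa_(n-k+1) of the recurrence vanishes
    ([continuant_Fpoly]). *)

(** * Spanning trees as rooted parent maps *)

Section ParentMaps.
Variables (T : finType) (e : rel T) (r : T).
Hypotheses (e_sym : symmetric e) (e_irr : irreflexive e).
Implicit Types (f g : {ffun T -> T}) (S : {set {set T}}).

Lemma eq_set2 (x y a b : T) :
  [set x; y] = [set a; b] -> x = a /\ y = b \/ x = b /\ y = a.
Proof.
move=> eq_xy.
have: x \in [set a; b] by rewrite -eq_xy set21.
have: y \in [set a; b] by rewrite -eq_xy set22.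
have: a \in [set x; y] by rewrite eq_xy set21.
have: b \in [set x; y] by rewrite eq_xy set22.
rewrite !inE => /orP[]/eqP hb /orP[]/eqP ha /orP[]/eqP hy /orP[]/eqP hx;
  by [left; split; congruence | right; split; congruence].
Qed.

(** A spanning tree is encoded by the map sending each vertex to the next one on
    its way to the root r; the root is sent to itself, so that these maps form
    a product over the vertices. *)
Definition parent_choice (x : T) : pred T :=
  fun y => if x == r then y == r else e x y.

Definition rooted f := [forall x, fconnect f x r].

Definition parent_edges f : {set {set T}} :=
  [set [set x; f x] | x in ~: [set r]].

Lemma depth_rooted f (d : T -> nat) :
  (forall x, x != r -> (d (f x) < d x)%N) -> rooted f.
Proof.
move=> d_lt; apply/forallP=> x; have [m] := ubnP (d x);
  elim: m x => // m IH x le_m.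
have [->|x_r] := eqVneq x r; first exact: connect0.
apply: connect_trans (fconnect1 f x) _; apply: IH.
exact: leq_trans (d_lt x x_r) _.
Qed.

(** A depth function is the form in which rootedness is used: every argument
    below picks a vertex of extremal depth. *)
Lemma rooted_depth f :
  rooted f -> exists d : T -> nat, forall x, x != r -> (d (f x) < d x)%N.
Proof.
move=> /forallP f_r.
have ex_m x : exists m, iter m f x == r.
  by exists (findex f x r); rewrite iter_findex.
exists (fun x => ex_minn (ex_m x)) => x x_r.
case: (ex_minnP (ex_m x)) => [[|m]] /=; first by rewrite (negPf x_r).
rewrite -iterS iterSr => fm_r min_m.
by case: ex_minnP => k _ k_min; rewrite ltnS; apply: k_min.
Qed.

Section Rooted.
Variables (f : {ffun T -> T}) (d : T -> nat).
Hypothesis d_lt : forall x, x != r -> (d (f x) < d x)%N.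

Lemma parent_edge x : x != r -> [set x; f x] \in parent_edges f.
Proof. by move=> x_r; apply: imset_f; rewrite !inE. Qed.

Lemma parent_edgesP x y : [set x; y] \in parent_edges f ->
  (x != r /\ y = f x) \/ (y != r /\ x = f y).
Proof.
case/imsetP=> z; rewrite !inE => z_r /eq_set2[][-> ->]; by [left|right].
Qed.

Lemma edge_adj_sym S : symmetric (edge_adj S).
Proof. by move=> x y; rewrite /edge_adj /= setUC. Qed.

Lemma parent_edges_connected : edge_connected (parent_edges f).
Proof.
have to_r x : connect (edge_adj (parent_edges f)) x r.
  have [m] := ubnP (d x); elim: m x => // m IH x le_m.
  have [->|x_r] := eqVneq x r; first exact: connect0.
  apply: (@connect_trans _ _ (f x)); first exact/connect1/parent_edge.
  by apply: IH; exact: leq_trans (d_lt x_r) _.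
apply/forallP=> x; apply/forallP=> y; apply: connect_trans (to_r x) _.
by rewrite (sym_connect_sym (@edge_adj_sym _)).
Qed.

(** Both neighbours in a cycle of a vertex of maximal depth have to be its
    parent. *)
Lemma parent_edges_acyclic : edge_acyclic (parent_edges f).
Proof.
apply/edge_acyclicP=> c c_gt2 uc.
have [x0 x0c] : exists x0, x0 \in c.
  by case: c c_gt2 {uc} => // x c _; exists x; rewrite mem_head.
case: (@arg_maxnP _ x0 (mem c) d x0c) => x xc x_max.
have par y : y \in c -> [set x; y] \in parent_edges f -> y = f x.
  move=> yc /parent_edgesP[][] // y_r def_x.
  have : (d y <= d x)%N := x_max y yc.
  by rewrite leqNgt def_x d_lt.
have [i p def_p] := rot_to xc.
have mem_p z : (z \in x :: p) = (z \in c) by rewrite -def_p mem_rot.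
have: size (x :: p) = size c by rewrite -def_p size_rot.
have: ucycle (edge_adj (parent_edges f)) (x :: p) by rewrite -def_p rot_ucycle.
case: p mem_p {def_p} => [|y [|z p]] mem_p; try by move=> _ sz;
  rewrite -sz in c_gt2.
rewrite /ucycle /= rcons_path => /and4P[/and4P[xy _ _ zx] _ y_p _] _.
have yf : y = f x by apply: par; rewrite // -mem_p !inE eqxx orbT.
have zf : last z p = f x.
  apply: par; first by rewrite -mem_p in_cons (in_cons y) mem_last !orbT.
  by rewrite setUC.
by move: y_p; rewrite yf -zf mem_last.
Qed.

End Rooted.

(** Were f x and g x different, the edge from x to f x would be the edge from
    f x to its g-parent x; as f and g agree on f x, which is closer to the root,
    x would then be its own f-grandparent. *)
Lemma parent_edges_inj f g :
    f \in family parent_choice -> g \in family parent_choice ->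
  rooted f -> rooted g -> parent_edges f = parent_edges g -> f = g.
Proof.
move=> /familyP fr /familyP gr /rooted_depth[d d_lt] _ eq_fg.
have rr h : (forall x, h x \in parent_choice x) -> h r = r.
  by move=> /(_ r); rewrite unfold_in /parent_choice eqxx => /eqP.
apply/ffunP=> x; have [m] := ubnP (d x); elim: m x => // m IH x le_m.
have [->|x_r] := eqVneq x r; first by rewrite !rr.
have: [set x; f x] \in parent_edges g by rewrite -eq_fg parent_edge.
case/parent_edgesP=> [[] // | [fx_r def_x]].
have lt_fx := d_lt x x_r.
have := IH (f x) (leq_trans lt_fx le_m); rewrite -def_x => ffx.
by have := d_lt _ fx_r; rewrite ffx ltnNge ltnW.
Qed.

Lemma parent_edges_spanning f : f \in family parent_choice -> rooted f ->
  parent_edges f \in spanning_trees e.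
Proof.
move=> /familyP fr /rooted_depth[d d_lt]; rewrite inE.
rewrite (parent_edges_connected d_lt) (parent_edges_acyclic d_lt) !andbT.
apply/subsetP=> _ /imsetP[x xr ->]; apply/imsetP; exists (x, f x) => //.
by have := fr x; rewrite !inE in xr *; rewrite unfold_in /parent_choice (negPf
  xr).
Qed.

(** The parent of x is a neighbour of x at smaller distance from the root.  An
    edge outside the resulting subtree would close a cycle with the path that
    joins its ends inside the subtree. *)
Lemma spanning_parent_edges S : S \in spanning_trees e ->
  exists f, [/\ f \in family parent_choice, rooted f & parent_edges f = S].
Proof.
rewrite inE => /and3P[/subsetP S_e /forallP S_conn /edge_acyclicP S_acyc].
have S_edge x y : edge_adj S x y -> e x y.
  move=> /S_e/imsetP[[a b]]; rewrite inE /= => ab.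
  by case/eq_set2 => [][-> ->] //; rewrite e_sym.
(* d is the distance to the root in the graph S. *)
have ex_m x : exists m,
    [exists t : m.-tuple T, path (edge_adj S) x t && (last x t == r)].
  have /forallP/(_ r)/connectP[p xp lp] := S_conn x.
  by exists (size p); apply/existsP; exists (in_tuple p); rewrite xp -lp eqxx.
pose d x := ex_minn (ex_m x).
have closer x : x != r -> exists y, edge_adj S x y && (d y < d x)%N.
  move=> x_r; rewrite /d; case: (ex_minnP (ex_m x)) => m /existsP[[t /= sz]].
  case: t sz => [|y t] sz /=; first by rewrite (negPf x_r).
  case/andP=> /andP[xy yt] lt _; exists y; rewrite xy /=.
  case: ex_minnP => k _ k_min; rewrite -(eqP sz) ltnS; apply: k_min.
  by apply/existsP; exists (in_tuple t); rewrite yt.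
pose f := [ffun x =>
  if x == r then r else odflt x [pick y | edge_adj S x y && (d y < d x)%N]].
have fP x : x != r -> edge_adj S x (f x) && (d (f x) < d x)%N.
  move=> x_r; rewrite ffunE (negPf x_r); case: pickP => //= none.
  by have [y] := closer x x_r; rewrite none.
have f_r : f \in family parent_choice.
  apply/familyP=> x; rewrite unfold_in /parent_choice.
  have [->|x_r] := eqVneq; first by rewrite ffunE eqxx.
  by apply: S_edge; case/andP: (fP x x_r).
have d_lt x : x != r -> (d (f x) < d x)%N by case/fP/andP.
exists f; split=> //; first exact: depth_rooted d_lt.
have fS : {subset parent_edges f <= S}.
  by move=> _ /imsetP[x xr ->]; rewrite !inE in xr; case/andP: (fP x xr).
apply/eqP; rewrite eqEsubset; apply/andP; split; apply/subsetP=> // E ES.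
have /imsetP[[u v] /=] := S_e E ES; rewrite inE /= => euv def_E.
apply: contraLR ES => EnS; apply/negP=> ES.
have /forallP/(_ u)/forallP/(_ v)/connectP[p0 p0P lp0]
  := parent_edges_connected d_lt.
case: (shortenP p0P) lp0 => p pP p_uniq _ lp {p0 p0P}.
have p_gt1 : (1 < size p)%N.
  case: p pP lp {p_uniq} => [|w [|? ?]] //=; first by move=> _ vu;
    rewrite vu e_irr in euv.
  by rewrite andbT => uw vw; case/negP: EnS; rewrite def_E vw.
apply: (S_acyc (u :: p)) => //; rewrite /ucycle p_uniq andbT /= rcons_path.
rewrite (sub_path _ pP) /= => [|x y]; last exact: fS.
by rewrite -lp edge_adj_sym /edge_adj /= -def_E.
Qed.

Lemma card_rooted :
  #|[set f in family parent_choice | rooted f]| = nb_spanning_trees e.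
Proof.
rewrite /nb_spanning_trees -(card_in_imset (f := parent_edges)).
  apply: eq_card => S; apply/imsetP/idP => [[f] | /spanning_parent_edges[f
    [fr rf <-]]].
    by rewrite inE => /andP[fr rf] ->; apply: parent_edges_spanning.
  by exists f; rewrite // inE fr.
by move=> f g; rewrite !inE => /andP[fr rf] /andP[gr rg];
  apply: parent_edges_inj.
Qed.

End ParentMaps.

(** * The matrix-tree theorem *)

Section MatrixTree.
Variables (R : comNzRingType) (T : finType) (e : rel T) (r : T).
Variables (N : nat) (h : 'I_N -> T).
Hypothesis h_bij : bijective h.

(** For z the parent of x, this is the entry (x, y) of 1 - A, where A is the
    adjacency matrix of the parent map with the column of the root erased. *)
Definition parent_entry (z x y : T) : R :=
  (x == y)%:R - ((z != r) && (z == y))%:R.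

Definition parent_matrix (f : T -> T) : 'M[R]_N :=
  \matrix_(i, j) parent_entry (f (h i)) (h i) (h j).

(** The row and the column of the root are replaced by those of the identity
    matrix instead of being deleted, which keeps all vertices as indices. *)
Definition reduced_laplacian : 'M[R]_N :=
  \matrix_(i, j)
    \sum_(z | parent_choice e r (h i) z) parent_entry z (h i) (h j).

(** Each row of the Laplacian is a sum over the neighbours of the vertex, and
    the determinant is linear in each row. *)
Lemma det_reduced_laplacian_sum :
  \det reduced_laplacian =
    \sum_(f in family (parent_choice e r)) \det (parent_matrix f).
Proof.
have [k hK kK] := h_bij.
rewrite /determinant exchange_big /=; apply: eq_bigr => s _.
rewrite -big_distrr /=; congr (_ * _).
have reix (G : 'I_N -> R) : \prod_i G i = \prod_x G (k x).
  by rewrite (reindex h) /=; [apply: eq_bigr => i _;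
    rewrite hK | exists k => ? _].
rewrite reix.
under eq_bigr => x _ do rewrite mxE kK.
rewrite bigA_distr_big_dep; apply: eq_bigr => f _; rewrite reix.
by apply: eq_bigr => x _; rewrite mxE kK.
Qed.

(** In the Leibniz formula only the identity contributes: a permutation with a
    nonzero term sends each vertex that it moves to its parent, so it cannot
    move a vertex of minimal depth among those. *)
Lemma det_parent_matrix_rooted (f : {ffun T -> T}) : f r = r ->
  rooted r f -> \det (parent_matrix f) = 1.
Proof.
move=> fr /rooted_depth[d d_lt]; rewrite /determinant (bigD1 (1%g : 'S_N)) //=
  odd_perm1.
rewrite mul1r big1 ?mulr1 => [|i _].
  rewrite big1 ?addr0 // => s s1.
  have [i0 i0P] : exists i, s i != i.
    apply/existsP; apply: contraR s1 => /existsPn s1.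
    by apply/eqP/permP=> i; rewrite perm1; apply/eqP; rewrite -[_ == _]negbK s1.
  case: (@arg_minnP _ i0 (fun i => s i != i) (d \o h) i0P) => i si i_min.
  rewrite (bigD1 i) //= mxE /parent_entry.
  have [f_si|f_si] := boolP ((f (h i) != r) && (f (h i) == h (s i)));
    last first.
    by rewrite (inj_eq (bij_inj h_bij)) eq_sym (negPf si) subr0 mul0r mulr0.
  have /andP[f_r /eqP f_s] := f_si.
  have i_r : h i != r by apply: contraNneq f_r => ->; rewrite fr.
  have : (d (h i) <= d (h (s i)))%N by apply: i_min; rewrite (inj_eq perm_inj).
  by rewrite leqNgt -f_s d_lt.
rewrite mxE perm1 /parent_entry eqxx.
case: andP => [[f_r /eqP f_i]|]; rewrite ?subr0 //.
have i_r : h i != r by rewrite -f_i.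
by have := d_lt _ i_r; rewrite f_i ltnn.
Qed.

(** The indicator of the vertices that do not reach the root is a nonzero
    vector in the kernel. *)
Lemma det_parent_matrix_unrooted (f : {ffun T -> T}) : f r = r ->
  ~~ rooted r f -> \det (parent_matrix f) = 0.
Proof.
move=> fr /forallPn[x0 x0_r]; have [k hK kK] := h_bij.
pose v : 'cV[R]_N := \col_i (~~ fconnect f (h i) r)%:R.
have Av : parent_matrix f *m v = 0.
  apply/colP=> i; rewrite !mxE.
  under eq_bigr => j _ do rewrite !mxE /parent_entry mulrBl.
  rewrite sumrB (bigD1 i) //= eqxx mul1r big1 => [|j ji]; last first.
    by rewrite (inj_eq (bij_inj h_bij)) eq_sym (negPf ji) mul0r.
  rewrite addr0 (bigD1 (k (f (h i)))) //= kK eqxx andbT big1 => [|j];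
    last first.
    rewrite -(inj_eq (bij_inj h_bij)) kK eq_sym => /negPf->.
    by rewrite andbF mul0r.
  apply/eqP; rewrite addr0 subr_eq0; apply/eqP.
  have [f_r|f_r] := eqVneq (f (h i)) r.
    by rewrite mul0r -f_r fconnect1.
  rewrite mul1r; congr (~~ _)%:R; apply/idP/idP;
    last exact: connect_trans (fconnect1 _ _).
  case/connectP=> [[|y p] /=]; first by move=> _ hr; rewrite -hr fr eqxx in f_r.
  by case/andP=> /eqP <- fp ->; apply/connectP; exists p.
have : (\det (parent_matrix f))%:M *m v = 0
  by rewrite -mul_adj_mx -mulmxA Av mulmx0.
rewrite mul_scalar_mx => /colP/(_ (k x0)).
by rewrite !mxE kK x0_r mulr1.
Qed.

Hypotheses (e_sym : symmetric e) (e_irr : irreflexive e).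

Theorem matrix_tree : \det reduced_laplacian = (nb_spanning_trees e)%:R.
Proof.
rewrite -(card_rooted r e_sym e_irr) det_reduced_laplacian_sum -sum1_card
  natr_sum.
rewrite [RHS](eq_bigl (fun f => (f \in family (parent_choice e r)) && rooted r
  f)); last first.
  by move=> f; rewrite inE.
rewrite big_mkcondr /=; apply: eq_bigr => f /familyP/(_ r).
rewrite unfold_in /parent_choice eqxx => /eqP fr.
by case: ifPn => rf; [apply: det_parent_matrix_rooted | apply:
  det_parent_matrix_unrooted].
Qed.
End MatrixTree.

(** * Two determinant identities *)

(** Both sides are the determinant of the block matrix with rows (1, -A) and
    (B, 1), eliminated in the two possible orders. *)
Lemma det_add1_mulC (R : comPzRingType) n (A B : 'M[R]_n) :
  \det (1%:M + A *m B) = \det (1%:M + B *m A).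
Proof.
pose X := block_mx 1%:M (- A) B 1%:M.
have eq1 : block_mx 1%:M 0 B 1%:M *m block_mx 1%:M (- A) 0 (1%:M + B *m A) = X.
  rewrite mulmx_block !mul1mx !mulmx1 !mul0mx !addr0 mulmxN.
  by rewrite addrCA addNr addr0.
have eq2 : block_mx 1%:M (- A) 0 1%:M *m block_mx (1%:M + A *m B) 0 B 1%:M = X.
  by rewrite mulmx_block !mul1mx !mulmx1 !mul0mx !add0r mulNmx addrK.
have := congr1 determinant eq1; rewrite -eq2 !det_mulmx.
by rewrite !det_lblock !det_ublock !det1 !mul1r mulr1.
Qed.

(** The determinant of a block triangular matrix.  The block decomposition is
    given by a projection E, so that the two diagonal blocks are completed by
    the identity to matrices of the same size as A. *)
Lemma det_block_trig (R : comPzRingType) n (A E : 'M[R]_n) :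
    E *m E = E -> E *m A *m (1%:M - E) = 0 ->
  \det A = \det (E *m A *m E + (1%:M - E))
           * \det ((1%:M - E) *m A *m (1%:M - E) + E).
Proof.
move=> EE; set G := 1%:M - E => EAF0.
have EG : E *m G = 0 by rewrite mulmxBr mulmx1 EE subrr.
have GE : G *m E = 0 by rewrite mulmxBl mul1mx EE subrr.
have GG : G *m G = G by rewrite {1}/G mulmxBl mul1mx EG subr0.
have E1 : E + G = 1%:M by rewrite addrC subrK.
clearbody G.
have decA : (E *m A *m E + G) *m (1%:M + G *m A *m E) *m (G *m A *m G + E) = A.
  have EGx B : E *m (G *m B) = 0 by rewrite mulmxA EG mul0mx.
  have GEx B : G *m (E *m B) = 0 by rewrite mulmxA GE mul0mx.
  have EEx B : E *m (E *m B) = E *m B by rewrite mulmxA EE.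
  have GGx B : G *m (G *m B) = G *m B by rewrite mulmxA GG.
  rewrite -mulmxA in EAF0.
  rewrite !(mulmxDl, mulmxDr) -!mulmxA ?(mulmx1, mul1mx).
  rewrite !(EGx, GEx, EEx, GGx, EG, GE, EE, GG, mulmx0, addr0, add0r).
  rewrite -[RHS]mul1mx -[RHS]mulmx1 -E1 !mulmxDl !mulmxDr -!mulmxA EAF0 addr0.
  by rewrite addrC -addrA.
rewrite -{1}decA !det_mulmx -(mulmxA G A E) det_add1_mulC -!mulmxA EG.
by rewrite mulmx0 addr0 det1 mulr1.
Qed.

(** * Block tridiagonal matrices with a Casimir operator *)

(** The rows and columns are graded by rk; U raises the rank by one and D lowers
    it by one.  The grading is used through the projections on the ranks, so no
    blocks of varying sizes are formed. *)
Section Graded.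
Variables (F : fieldType) (N : nat) (rk : 'I_N.+1 -> nat).
Local Notation M := 'M[F]_N.+1.

Definition rank_diag (u : nat -> F) : M := diag_mx (\row_i u (rk i)).

Lemma rank_diagE u (i j : 'I_N.+1) : rank_diag u i j = u (rk i) *+ (i == j).
Proof. by rewrite !mxE. Qed.

Lemma eq_rank_diag u v :
  (forall i, u (rk i) = v (rk i)) -> rank_diag u = rank_diag v.
Proof. by move=> uv; apply/matrixP=> i j; rewrite !rank_diagE uv. Qed.

Lemma rank_diagM u v :
  rank_diag u * rank_diag v = rank_diag (fun i => u i * v i).
Proof.
by rewrite [LHS]mulmx_diag; congr diag_mx; apply/rowP=> i; rewrite !mxE.
Qed.

Lemma rank_diagB u v :
  rank_diag u - rank_diag v = rank_diag (fun i => u i - v i).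
Proof. by apply/matrixP=> i j; rewrite !mxE mulrnBl. Qed.

Lemma rank_diagZ c u : rank_diag (fun i => c * u i) = c *: rank_diag u.
Proof. by apply/matrixP=> i j; rewrite !mxE mulrnAr. Qed.

Lemma rank_diag_const c : rank_diag (fun=> c) = c%:M.
Proof. by apply/matrixP=> i j; rewrite !mxE. Qed.

Lemma rank_diag1 : rank_diag (fun=> 1) = 1.
Proof. exact: rank_diag_const. Qed.

Definition rank_proj j := rank_diag (fun i => (i == j)%:R).
Definition rank_ge j := rank_diag (fun i => (j <= i)%N%:R).

Lemma proj_idem j : rank_proj j * rank_proj j = rank_proj j.
Proof.
by rewrite rank_diagM; apply: eq_rank_diag => i; rewrite -natrM mulnb andbb.
Qed.

Definition level j := #|[set i | rk i == j]|.

Lemma det_scale_proj c j :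
  \det (c *: rank_proj j + (1 - rank_proj j)) = c ^+ level j.
Proof.
have -> : c *: rank_proj j + (1 - rank_proj j)
    = rank_diag (fun i => if i == j then c else 1).
  apply/matrixP=> i k; rewrite -rank_diag1 rank_diagB !mxE.
  by case: (rk i == j); case: (i == k); rewrite /= ?mulr1n ?mulr0n; ring.
rewrite det_diag /level -prodr_const [RHS]big_mkcond /=.
by apply: eq_bigr => i _; rewrite !mxE inE.
Qed.

Lemma det_proj_shift c j (X : M) : c != 0 ->
  \det (rank_proj j * (c%:M + X) + (1 - rank_proj j))
    = c ^+ level j * \det (1%:M + c^-1 *: (rank_proj j * X)).
Proof.
move=> c0; rewrite -det_scale_proj -det_mulmx; congr determinant.
rewrite mulmxE; move: (rank_proj j) (proj_idem j) => P PP.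
rewrite idmxE [RHS]mulrDr mulr1 [X in _ = _ + X]mulrDl -scalerAl -!scalerAr
  scalerA divff //.
rewrite scale1r mulrA PP mulrBl mul1r mulrA PP subrr scaler0 addr0.
by rewrite mulrDr -mulmxE mul_mx_scalar addrAC.
Qed.

Variables (n : nat) (U D : M) (kap a : nat -> F).
Hypothesis rk_le : forall i, (rk i <= n)%N.
Hypothesis rkU : forall i j, U i j != 0 -> rk i = (rk j).+1.
Hypothesis rkD : forall i j, D i j != 0 -> rk j = (rk i).+1.
Hypothesis DU_UD :
  D * U + rank_diag (fun i => kap i.+1) = U * D + rank_diag kap.

Lemma U_diag u : U * rank_diag (fun i => u i.+1) = rank_diag u * U.
Proof.
rewrite -[LHS]/(_ *m _) -[RHS]/(_ *m _) mul_mx_diag mul_diag_mx.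
apply/matrixP=> i j; rewrite !mxE mulrC.
by have [->|/rkU->//] := eqVneq (U i j) 0; rewrite !mulr0.
Qed.

Lemma D_diag u : D * rank_diag u = rank_diag (fun i => u i.+1) * D.
Proof.
rewrite -[LHS]/(_ *m _) -[RHS]/(_ *m _) mul_mx_diag mul_diag_mx.
apply/matrixP=> i j; rewrite !mxE mulrC.
by have [->|/rkD->//] := eqVneq (D i j) 0; rewrite !mulr0.
Qed.

(** By the hypothesis on D U - U D this is also D U + kappa_(rank + 1), and the
    comparison of the two forms makes it commute with U and D. *)
Definition casimir := U * D + rank_diag kap.
Local Notation C := casimir.

Lemma casimirE : C = D * U + rank_diag (fun i => kap i.+1).
Proof. by rewrite DU_UD. Qed.

Lemma comm_U_casimir : comm_mx U C.
Proof.
rewrite /comm_mx !mulmxE {1}casimirE /casimir mulrDr mulrDl mulrA.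
by rewrite (U_diag kap).
Qed.

Lemma comm_diag_casimir u : comm_mx (rank_diag u) C.
Proof.
rewrite /comm_mx !mulmxE /casimir mulrDr mulrDl !rank_diagM mulrA -U_diag
  -mulrA -D_diag.
by rewrite mulrA; congr (_ + _); apply: eq_rank_diag => i; rewrite mulrC.
Qed.

Local Notation pC p := (horner_mx C p).

Lemma U_pC p : U * pC p = pC p * U.
Proof. exact/comm_mx_horner/comm_U_casimir. Qed.
Lemma diag_pC u p : rank_diag u * pC p = pC p * rank_diag u.
Proof. exact/comm_mx_horner/comm_diag_casimir. Qed.

(** The determinant of p(C) on the elements of rank j. *)
Definition level_det j p := \det (rank_proj j * pC p + (1 - rank_proj j)).

Lemma U_proj j : U * rank_proj j = rank_proj j.+1 * U.
Proof. by rewrite -U_diag. Qed.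

Lemma diag_proj u j : rank_diag u * rank_proj j = u j *: rank_proj j.
Proof.
rewrite rank_diagM -rank_diagZ; apply: eq_rank_diag => i.
by have [->|_] := eqVneq (rk i) j; rewrite // !mulr0.
Qed.

Lemma proj_diag u j : rank_proj j * rank_diag u = u j *: rank_proj j.
Proof.
by rewrite -diag_proj !rank_diagM; apply: eq_rank_diag => i; rewrite mulrC.
Qed.

Lemma horner_mx_factor p c :
  exists h, pC p = p.[c]%:M + pC h * (C - c%:M).
Proof.
have /factor_theorem[h ph] : root (p - p.[c]%:P) c.
  by rewrite rootE !hornerE subrr.
exists h; have -> : p = p.[c]%:P + h * ('X - c%:P) by rewrite -ph addrC subrK.
by rewrite rmorphD rmorphM rmorphB /= !horner_mx_C horner_mx_X !hornerE subrr
  mulr0 addr0.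
Qed.

Lemma UD_proj j : U * D * rank_proj j = (C - (kap j)%:M) * rank_proj j.
Proof.
by rewrite mulrBl -mulmxE mul_scalar_mx -diag_proj mulmxE -mulrBl addrK.
Qed.

Lemma DU_proj j : D * U * rank_proj j = (C - (kap j.+1)%:M) * rank_proj j.
Proof.
rewrite mulrBl -mulmxE mul_scalar_mx mulmxE.
by rewrite -(diag_proj (fun i => kap i.+1)) -mulrBl casimirE addrK.
Qed.

(** With c = p(kappa_(j+1)) one has p(C) = c + h(C) (C - kappa_(j+1)), where
    C - kappa_(j+1) is U D in rank j+1 and D U in rank j.  Thus p(C) / c is
    1 + A B in rank j+1 and 1 + B A in rank j, with A = U and B = h(C) D. *)
Lemma level_det_rec j p : p.[kap j.+1] != 0 ->
  level_det j.+1 p * p.[kap j.+1] ^+ level j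
    = level_det j p * p.[kap j.+1] ^+ level j.+1.
Proof.
set c := p.[_] => c0; have [h ph] := horner_mx_factor p (kap j.+1).
rewrite -/c in ph; set X := pC h * _ in ph.
have Xdiag u : X * rank_diag u = rank_diag u * X.
  have -> : X = pC p - c%:M by rewrite ph addrAC subrr add0r.
  by rewrite mulrBr mulrBl -diag_pC -!mulmxE scalar_mxC.
rewrite /level_det ph !det_proj_shift // mulrAC
  [RHS]mulrAC (mulrC (c ^+ level j)).
congr (_ * _); set E := rank_proj j; set E' := rank_proj j.+1.
pose A := E' * U; pose B := pC h * D * E'.
have AB : A * B = E' * X.
  rewrite /A /B !mulrA -(mulrA E' U) U_pC -!mulrA (mulrA U D) UD_proj.
  by rewrite (mulrA (pC h)) Xdiag !mulrA proj_idem.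
have BA : B * A = E * X.
  rewrite /A /B -!mulrA (mulrA E') proj_idem -U_proj (mulrA D) DU_proj.
  by rewrite mulrA Xdiag.
rewrite -AB -BA.
have := det_add1_mulC (c^-1 *: A) B.
by rewrite !mulmxE -scalerAl -scalerAr.
Qed.

Lemma D_proj0 : D * rank_proj 0 = 0.
Proof.
rewrite D_diag; suff -> : rank_diag (fun i => (i.+1 == 0)%:R) = 0
  by rewrite mul0r.
by apply/matrixP=> i j; rewrite !mxE mul0rn.
Qed.

(** In rank 0 the operator D vanishes, so C is the scalar kappa_0. *)
Lemma level_det0 p : level_det 0 p = p.[kap 0] ^+ level 0.
Proof.
have CP : (C - (kap 0)%:M) * rank_proj 0 = 0
  by rewrite -UD_proj -mulrA D_proj0 mulr0.
have [h ph] := horner_mx_factor p (kap 0).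
rewrite -det_scale_proj /level_det; congr (\det (_ + _)).
by rewrite diag_pC ph mulrDl -mulrA CP mulr0 addr0 -mulmxE mul_scalar_mx.
Qed.

(** Continuants of the tridiagonal matrix, with the product of the off-diagonal
    entries between the ranks i and i+1 equal to X - kappa_(i+1); they are built
    from the top rank, m being the distance of the index below n+2. *)
Fixpoint continuant_rec m : {poly F} :=
  match m with
  | 0 => 0
  | m1.+1 =>
    match m1 with
    | 0 => 1
    | m2.+1 => a (n - m2)%N *: continuant_rec m1
               - ('X - (kap (n - m2).+1)%:P) * continuant_rec m2
    end
  end.

Definition continuant i := continuant_rec (n.+2 - i).
Local Notation K := continuant.

Lemma continuant_last : K n.+1 = 1.
Proof. by rewrite /continuant subSn // subnn. Qed.

Lemma continuant_over : K n.+2 = 0.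
Proof. by rewrite /continuant subnn. Qed.

Lemma continuantE i : (i <= n)%N ->
  K i = a i *: K i.+1 - ('X - (kap i.+1)%:P) * K i.+2.
Proof.
move=> le_in; rewrite /continuant !subSS.
by rewrite -{1}(subnKC le_in) -2!addnS addKn /= subKn // (subSn le_in).
Qed.

Definition tridiag := rank_diag a - U - D.

(** The principal block of the ranks at least j, completed by the identity. *)
Definition tridiag_from j := rank_ge j * tridiag * rank_ge j + (1 - rank_ge j).

Lemma U_exp_proj m j : U ^+ m * rank_proj j = rank_proj (m + j)%N * U ^+ m.
Proof.
elim: m => [|m IH]; first by rewrite expr0 mul1r mulr1.
by rewrite !exprS -mulrA IH mulrA U_proj mulrA.
Qed.

Lemma proj_gt_eq0 j : (n < j)%N -> rank_proj j = 0.
Proof.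
move=> lt_nj; apply/matrixP=> i k; rewrite !mxE.
by rewrite ltn_eqF ?mul0rn // (leq_ltn_trans (rk_le i)).
Qed.

Definition chain j i := rank_proj i * U ^+ (i - j).

Lemma chain_diag j : chain j j = rank_proj j.
Proof. by rewrite /chain subnn mulr1. Qed.

Lemma U_chain j i : (j <= i)%N -> U * chain j i = chain j i.+1.
Proof. by move=> le_ji; rewrite /chain mulrA U_proj subSn // exprS mulrA. Qed.

Lemma chain_proj j i : (j <= i)%N -> chain j i * rank_proj j = chain j i.
Proof.
move=> le_ji.
by rewrite /chain -mulrA U_exp_proj subnK // mulrA proj_idem.
Qed.

Lemma casimir_chain j i : C * chain j i = chain j i * C.
Proof.
rewrite /chain mulrA -[C * _]comm_diag_casimir -!mulrA; congr (_ * _).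
by apply: commrX; apply: commr_sym; apply: comm_U_casimir.
Qed.

(** The block column by which the matrix is multiplied to clear its block
    column j below the diagonal: its entries are the continuants, as for the
    solution of a scalar three-term recurrence. *)
Definition elim_column j :=
  \sum_(j <= i < n.+1) chain j i * pC (K i.+1).

Lemma upper_D_proj j : rank_ge j * D * rank_proj j = 0.
Proof.
rewrite -mulrA D_diag mulrA rank_diagM.
suff -> : rank_diag (fun i => (j <= i)%N%:R * (i.+1 == j)%:R) = 0
  by rewrite mul0r.
apply/matrixP=> i k; rewrite !mxE -natrM mulnb.
by case: eqP => [<-|_]; rewrite ?ltnn ?andbF mul0rn.
Qed.

(** The image of the i-th term telescopes by the recurrence of the continuants.
    At the lower end the matrix also reaches rank j-1, which rank_ge j kills. *)
Lemma tridiag_elim_column j : (j <= n)%N ->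
  rank_ge j * (tridiag * elim_column j) = rank_proj j * pC (K j).
Proof.
move=> le_jn.
pose V i := chain j i * pC (K i.+1).
pose G i := chain j i * pC (K i).
have step i : (j <= i < n.+1)%N ->
    tridiag * V i = (D * V i.+1 - G i.+1) - (D * V i - G i).
  case/andP=> le_ji le_in.
  have aV : rank_diag a * V i = a i *: V i.
    by rewrite /V /chain !mulrA diag_proj -!scalerAl.
  have UV : U * V i = G i.+1 by rewrite /V mulrA U_chain.
  have DV : D * V i.+1 = chain j i * ((C - (kap i.+1)%:M) * pC (K i.+2)).
    rewrite /V -U_chain // !mulrA; congr (_ * _).
    rewrite DU_proj -mulrA -/(chain j i).
    by rewrite mulrBl mulrBr casimir_chain -!mulmxE scalar_mxC.
  have KG : G i = a i *: V i - D * V i.+1.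
    rewrite DV /G continuantE // rmorphB /= horner_mxZ rmorphM rmorphB /=.
    by rewrite horner_mx_X horner_mx_C mulrBr -scalerAr.
  rewrite /tridiag !mulrBl aV UV KG.
  by rewrite opprB addrA [X in _ = X - _]addrC addrA subrK.
rewrite /elim_column big_distrr /= (telescope_sumr_eq (fun i
  => D * V i - G i)) //; last exact: leqW.
have -> : V n.+1 = 0 by rewrite /V continuant_over rmorph0 mulr0.
have -> : G n.+1 = 0 by rewrite /G /chain proj_gt_eq0 // !mul0r.
rewrite mulr0 subr0 sub0r opprB mulrBr /V /G chain_diag !mulrA upper_D_proj.
by rewrite mul0r subr0 /rank_ge diag_proj leqnn scale1r.
Qed.

(** One step of the elimination, without division: block column j is replaced
    by its product with the elimination column, whose own diagonal block is
    K_(j+1)(C), and K_j(C) becomes the diagonal block. *)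
Lemma det_tridiag_from_rec j : (j <= n)%N ->
  \det (tridiag_from j) * level_det j (K j.+1)
    = \det (tridiag_from j.+1) * level_det j (K j).
Proof.
move=> le_jn; set E := rank_proj j; set G := 1 - E.
have EE : E * E = E := proj_idem j.
have EG : E * G = 0 by rewrite mulrBr mulr1 EE subrr.
have GE : G * E = 0 by rewrite mulrBl mul1r EE subrr.
have GG : G * G = G by rewrite {1}/G mulrBl mul1r EG subr0.
pose W := elim_column j.
have WE : W * E = W.
  rewrite /W /elim_column mulr_suml; apply: eq_big_nat => i /andP[le_ji _].
  by rewrite -mulrA -diag_pC mulrA chain_proj.
have EW : E * W = E * pC (K j.+1).
  rewrite /W /elim_column big_ltn // chain_diag mulrDr mulrA EE big_distrr /=.
  rewrite big_nat big1 ?addr0 // => i /andP[lt_ji _].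
  by rewrite !mulrA diag_proj gtn_eqF // scale0r !mul0r.
have uW : rank_ge j * W = W.
  rewrite /W /elim_column big_distrr /=; apply: eq_big_nat => i /andP[le_ji _].
  by rewrite !mulrA diag_proj le_ji scale1r.
have EpE p : E * pC p * E = E * pC p by rewrite diag_pC -mulrA EE.
have E1G : 1 - G = E by rewrite opprB addrC subrK.
pose Z := G + W.
have detZ : \det Z = level_det j (K j.+1).
  have EZ : E * Z = E * pC (K j.+1) by rewrite mulrDr EG add0r EW.
  have ZG : Z * G = G by rewrite mulrDl GG -WE -mulrA EG mulr0 addr0.
  rewrite (@det_block_trig _ _ Z E) //; rewrite !mulmxE idmxE -/G.
    by rewrite -[G * Z * G]mulrA ZG GG EZ EpE subrK det1 mulr1.
  by rewrite -mulrA ZG EG.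
have MZ : tridiag_from j * Z = tridiag_from j * G + E * pC (K j).
  rewrite mulrDr; congr (_ + _); rewrite /tridiag_from mulrDl -!mulrA uW.
  by rewrite tridiag_elim_column // mulrBl mul1r uW subrr addr0.
have defG : G = 1 - E by [].
clearbody G; rewrite -detZ -det_mulmx mulmxE MZ (@det_block_trig _ _ _ G) //;
  rewrite !mulmxE idmxE E1G.
  have uG : rank_ge j * G = rank_ge j.+1.
    rewrite defG mulrBr mulr1 rank_diagM rank_diagB; apply: eq_rank_diag => i.
    by rewrite -natrM mulnb; case: ltngtP; rewrite ?subr0 ?subrr.
  have Gu : G * rank_ge j = rank_ge j.+1.
    by rewrite defG mulrBl mul1r -uG defG mulrBr mulr1 diag_proj proj_diag.
  rewrite /level_det -/E -defG; congr (_ * _); congr determinant.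
    rewrite mulrDr mulrDl (mulrA G E) GE !mul0r addr0 -!mulrA GG /tridiag_from.
    have <- : G * ((1 - rank_ge j) * G) + E = 1 - rank_ge j.+1.
      rewrite mulrBl mul1r uG mulrBr GG -{1}Gu mulrA GG Gu.
      by rewrite addrAC defG subrK.
    by rewrite mulrDl mulrDr -!mulrA uG !mulrA Gu addrA.
  by rewrite mulrDr mulrDl -!mulrA GE !mulr0 add0r (mulrA E E) EE mulrA EpE.
by rewrite mulrDr mulrDl (mulrA G E) GE !mul0r addr0 -!mulrA GE !mulr0.
Qed.

Lemma tridiag_from_over : tridiag_from n.+1 = 1.
Proof.
rewrite /tridiag_from (_ : rank_ge n.+1 = 0) ?mulr0 ?mul0r ?add0r ?subr0 //.
by apply/matrixP=> i k; rewrite !mxE ltnNge rk_le mul0rn.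
Qed.

Definition level_diff j : int := (level j)%:Z - (level j.-1)%:Z.

(** The case of nonzero values, where the multiplicities of kappa_(j+1) in the
    ranks j and j+1 can be subtracted even when the difference is negative. *)
Lemma level_detS j p : p.[kap j.+1] != 0 ->
  level_det j.+1 p = level_det j p * p.[kap j.+1] ^ level_diff j.+1.
Proof.
move=> c0; apply: (mulIf (expf_neq0 (level j) c0)); rewrite level_det_rec //.
by rewrite -mulrA !exprnP -expfzDr // subrK.
Qed.

(** The product over the elimination steps.  It is kept in the form of an
    invariant relating the determinants for the ranks from 1 and from m+1, in
    which each step contributes the single factor K_m(kappa_m). *)
Theorem det_tridiag_from1 :
    (forall i k, (i <= n.+1)%N -> (k <= i)%N -> (0 < i)%N ->
      (K i).[kap k] != 0) ->
  \det (tridiag_from 1) = (K 1).[kap 0] ^+ level 0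
    * \prod_(1 <= j < n.+1) (K j).[kap j] ^ level_diff j.
Proof.
move=> K0.
have Kdet0 i j : (i <= n.+1)%N -> (j <= i)%N -> (0 < i)%N ->
    level_det j (K i) != 0.
  move=> le_in; elim: j => [|j IH] le_ji i_gt0.
    by rewrite level_det0 expf_neq0 ?K0.
  by rewrite level_detS ?K0 // mulf_neq0 ?expfz_neq0 ?K0 ?IH // ltnW.
suff IH m : (m <= n)%N ->
    \det (tridiag_from 1) * level_det m (K m.+1)
    = \det (tridiag_from m.+1) * level_det 0 (K 1)
      * \prod_(1 <= j < m.+1) (K j).[kap j] ^ level_diff j.
  have := IH n (leqnn n); rewrite tridiag_from_over det1 mul1r level_det0.
  by rewrite continuant_last /level_det rmorph1 mulr1 addrC subrK det1 mulr1.
elim: m => [|m IHm] le_mn; first by rewrite big_geq // mulr1.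
apply: (mulIf (Kdet0 m.+1 m _ _ _)); rewrite // 1?ltnW //.
rewrite [in RHS]big_nat_recr //= mulrAC IHm 1?ltnW //.
have := det_tridiag_from_rec le_mn.
rewrite [X in _ = _ * X]level_detS ?K0 //; last exact: ltnW.
move: (_ ^ _) (bigop _ _ _) (level_det _ _) (level_det 0 _) (level_det m.+1 _).
move: (\det (tridiag_from m.+1)) (\det (tridiag_from m.+2))
  => x y e p b c d eq1.
have -> : x * c * p * d = x * d * (c * p) by ring.
by rewrite eq1; ring.
Qed.
End Graded.

(** * Covering relations between subspaces *)

(** The vectors of V are counted in its alias finvect_type V, which is a finite
    type. *)
Definition points (F : finFieldType) (V : vectType F) (y : {vspace V}) :=
  [set v : finvect_type V | (v : V) \in y].

Lemma card_points (F : finFieldType) (V : vectType F) (y : {vspace V}) :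
  #|points y| = (#|F| ^ \dim y)%N.
Proof.
case: V y => T cT y.
rewrite -(@card_vspace F (finvect_type (Vector.Pack cT)) cT y).
by apply: eq_card => v; rewrite inE.
Qed.

Section Covers.
Variables (F : finFieldType) (V : vectType F).
Implicit Types x y z : {vspace V}.
Local Notation q := #|F|.

Definition covers z y := (z <= y)%VS && (\dim y == (\dim z).+1).

Definition qnat k : nat := (\sum_(i < k) q ^ i)%N.

Lemma q_gt1 : (1 < q)%N. Proof. exact: finNzRing_gt1. Qed.

Lemma qnatS k : qnat k.+1 = (1 + q * qnat k)%N.
Proof.
rewrite /qnat big_ord_recl expn0 big_distrr /=; congr (_ + _)%N.
by apply: eq_bigr => i _; rewrite -expnS.
Qed.

Lemma qnat_gt0 k : (0 < k)%N -> (0 < qnat k)%N.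
Proof. by case: k => // k; rewrite qnatS. Qed.

Lemma dim_add_line z (v : V) : v \notin z -> \dim (z + <[v]>) = (\dim z).+1.
Proof.
move=> vz; apply/eqP; rewrite eqn_leq; apply/andP; split.
  apply: leq_trans (dimv_add_leqif z <[v]>) _.
  by rewrite dim_vline -addn1 leq_add2l; case: (_ != _).
rewrite ltnNge; apply: contra vz => le_dim.
have /eqP-> : z == (z + <[v]>)%VS by rewrite eqEdim addvSl.
exact: subvP (addvSr z _) _ (memv_line v).
Qed.

(** A cover of z is determined by any of its vectors outside z. *)
Lemma covers_lineP z y (v : V) : v \notin z ->
  covers z y && (v \in y) = (y == (z + <[v]>)%VS).
Proof.
move=> vz; apply/idP/eqP => [/andP[/andP[zy /eqP dy] vy] | ->].
  by apply/eqP; rewrite eq_sym eqEdim subv_add zy -memvE vy dy dim_add_line /=.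
rewrite /covers addvSl dim_add_line // eqxx /=.
exact: subvP (addvSr z _) _ (memv_line v).
Qed.

(** The sets y \ z, for y a cover of z inside x, partition x \ z, and they all
    have q^(dim z) * (q - 1) elements. *)
Lemma card_up z x : (z <= x)%VS ->
  #|[set y | covers z y & (y <= x)%VS]| = qnat (\dim x - \dim z).
Proof.
move=> zx; set A := [set y | _ & _].
have sum_pts : (\sum_(y in A) #|points y :\: points z|
                = #|points x :\: points z|)%N.
  under eq_bigr => y _ do rewrite -sum1_card.
  rewrite -sum1_card (exchange_big_dep (mem (points x :\: points z))) /=.
    apply: eq_bigr => v; rewrite !inE => /andP[vz vx].
    rewrite (big_pred1 (z + <[v : V]>)%VS) // => y; rewrite !inE vz /=.
    rewrite -covers_lineP // andbAC; apply: andb_idr.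
    by rewrite covers_lineP // => /eqP->; rewrite subv_add zx -memvE.
  by move=> y v; rewrite !inE => /andP[_ yx] /andP[-> /(subvP yx)].
have card_diff y : (z <= y)%VS ->
    #|points y :\: points z| = (q ^ \dim z * (q.-1 * qnat (\dim y - \dim z)))%N.
  move=> zy; rewrite cardsD (setIidPr _); last first.
    by apply/subsetP=> v; rewrite !inE => /(subvP zy).
  rewrite !card_points -predn_exp -subn1 mulnBr muln1 -expnD subnKC //.
  exact: dimvS.
move: sum_pts; rewrite card_diff // (eq_bigr (fun=> (q ^ \dim z * q.-1)%N));
  last first.
  move=> y; rewrite inE => /andP[/andP[zy /eqP dy] _].
  by rewrite card_diff // dy subSn // subnn /qnat big_ord1 expn0 muln1.
rewrite sum_nat_const mulnC (mulnA (q ^ _)%N) => /eqP;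
  rewrite eqn_pmul2l => [/eqP //|].
by rewrite muln_gt0 expn_gt0 -subn1 subn_gt0 q_gt1 ltnW ?q_gt1.
Qed.

Lemma ex_covers_down x d : \dim x = d.+1 -> exists y, covers y x.
Proof.
move=> dx.
suff [y yx dy] : exists2 y, (y <= x)%VS & \dim y = d.
  by exists y; rewrite /covers yx dx dy /=.
have : (d <= \dim x)%N by rewrite dx.
elim: (d) => [|k IH] le_k; first by exists 0%VS; rewrite ?sub0v ?dimv0.
have [y yx dy] := IH (ltnW le_k).
have : (0 < #|[set w | covers y w & (w <= x)%VS]|)%N.
  by rewrite card_up // qnat_gt0 // dy subn_gt0.
case/card_gt0P=> w; rewrite inE => /andP[/andP[_ /eqP dw] wx].
by exists w; rewrite // dw dy.
Qed.

Lemma dim_cap_hyper x y1 y2 : covers y1 x -> covers y2 x -> y1 != y2 ->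
  (\dim (y1 :&: y2)).+1 = \dim y2.
Proof.
move=> /andP[y1x /eqP d1] /andP[y2x /eqP d2] ne.
have := dimv_sum_cap y1 y2.
have : (\dim (y1 + y2) <= \dim x)%N by rewrite dimvS // subv_add y1x.
have : (\dim y1 < \dim (y1 + y2))%N.
  rewrite ltnNge; apply: contra ne => le_d.
  have e1 : y1 == (y1 + y2)%VS by rewrite eqEdim addvSl.
  rewrite eq_sym eqEdim; apply/andP; split; last by lia.
  by rewrite (eqP e1) addvSr.
lia.
Qed.

(** By induction on the dimension of x.  Fix a hyperplane y0.  The other
    hyperplanes of x meet y0 in a hyperplane z of y0, and by [card_up] each such
    z lies in q + 1 hyperplanes of x, one of which is y0.  Hence the count d
    satisfies d(x) = 1 + q * d(y0). *)
Lemma card_down x : #|[set y | covers y x]| = qnat (\dim x).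
Proof.
have [d] := ubnP (\dim x); elim: d x => // d IH x.
case dx : (\dim x) => [|k] lt_kd.
  rewrite /qnat big_ord0; apply: eq_card0 => y; rewrite !inE /covers dx.
  by rewrite andbC.
have [y0 y0x] := ex_covers_down dx.
have [y0_x dy0] : (y0 <= x)%VS /\ \dim y0 = k.
  by case/andP: y0x => -> /eqP; rewrite dx => -[].
rewrite (cardsD1 y0) inE y0x qnatS; congr (_ + _)%N.
rewrite -sum1_card (partition_big (fun y => (y :&: y0)%VS)
                                (mem [set z | covers z y0])) /=; last first.
  move=> y; rewrite !inE => /andP[y_y0 yx].
  by rewrite /covers capvSr -(dim_cap_hyper yx y0x y_y0) eqxx.
rewrite (eq_bigr (fun=> q)); first by rewrite sum_nat_const IH dy0 1?mulnC //;
  lia.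
move=> z; rewrite inE => zy0; have [z_y0 /eqP dz] := andP zy0.
have := card_up (subv_trans z_y0 y0_x).
rewrite dx -dy0 dz.
rewrite (_ : (_ - _ = 2)%N); last by lia.
rewrite (cardsD1 y0) inE zy0 y0_x /= !qnatS (_ : qnat 0 = 0%N) /qnat ?big_ord0
  //.
rewrite muln0 addn0 muln1 => /eqP; rewrite eqn_add2l => /eqP<-;
  rewrite sum1_card; apply: eq_card => y.
rewrite unfold_in !inE; apply/idP/idP => [/andP[/andP[ne yx] /eqP <-] | ].
  have [y_x /eqP dyx] := andP yx.
  by rewrite ne y_x andbT /covers capvSl -(dim_cap_hyper y0x yx) 1?eq_sym
    // capvC eqxx.
move=> /andP[ne /andP[/andP[zy /eqP dy] y_x]].
have yx : covers y x by rewrite /covers y_x dy -dz dy0 dx /=.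
rewrite ne yx /= eq_sym eqEdim subv_cap zy z_y0.
by have := dim_cap_hyper yx y0x ne; rewrite dz => -[->] /=.
Qed.

(** The only candidates are x + y and the intersection of x and y, and each of
    them covers or is covered under the same condition on dimensions. *)
Lemma covers_both_up x y : x != y ->
  #|[set z | covers x z & covers y z]| = #|[set z | covers z x & covers z y]|.
Proof.
move=> ne.
have both (b : bool) w (P : pred {vspace V}) :
    (forall z, P z = b && (z == w)) -> #|[set z | P z]| = b :> nat.
  move=> Pw; rewrite (eq_card (B := fun z => b && (z == w))) => [|z];
    last by rewrite inE Pw.
  by case: b {Pw}; rewrite ?card0 // ?card1.
pose b1 := (\dim x == \dim y) && (\dim (x + y) == (\dim x).+1).
pose b2 := (\dim x == \dim y) && ((\dim (x :&: y)).+1 == \dim x).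
have eq_b : b1 = b2 by rewrite /b1 /b2; have := dimv_sum_cap x y; lia.
rewrite (both b1 (x + y)%VS) ?(both b2 (x :&: y)%VS) ?eq_b // => z.
  apply/idP/idP => [/andP[zx zy] | /andP[/andP[/eqP dxy /eqP dc] /eqP->]].
    have [zx' /eqP dx] := andP zx; have [zy' /eqP dy] := andP zy.
    have z_cap : (z <= x :&: y)%VS by rewrite subv_cap zx' zy'.
    have lt_cap : (\dim (x :&: y) < \dim x)%N.
      rewrite ltnNge; apply: contra ne => le_cap.
      have /eqP e1 : (x :&: y)%VS == x by rewrite eqEdim capvSl.
      by rewrite eqEdim -{1}e1 capvSr dy dx leqnn.
    have /eqP ez : z == (x :&: y)%VS by rewrite eqEdim z_cap -ltnS -dx.
    by rewrite /b2 -ez dx dy !eqxx.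
  by rewrite /covers capvSl capvSr -dxy -dc eqxx.
rewrite -eq_b; apply/idP/idP => [/andP[xz yz] | /andP[/andP[/eqP dxy /eqP ds]
  /eqP->]].
  have [xz' /eqP dx] := andP xz; have [yz' /eqP dy] := andP yz.
  have sum_z : (x + y <= z)%VS by rewrite subv_add xz' yz'.
  have lt_sum : (\dim x < \dim (x + y))%N.
    rewrite ltnNge; apply: contra ne => le_sum.
    have /eqP e1 : x == (x + y)%VS by rewrite eqEdim addvSl.
    by rewrite eq_sym eqEdim {1}e1 addvSr -ltnS -dx dy ltnS leqnn.
  have /eqP ez : (x + y)%VS == z by rewrite eqEdim sum_z dx.
  by rewrite /b1 ez !eqxx dx andbT -eqSS -dx dy eqxx.
by rewrite /covers addvSl addvSr -dxy ds eqxx.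
Qed.

Lemma card_upf z : #|[set y | covers z y]| = qnat (\dim {:V} - \dim z).
Proof.
by rewrite -(card_up (subvf z)); apply: eq_card => y; rewrite !inE subvf andbT.
Qed.

(** Both sides count the covering pairs between the dimensions k and k+1. *)
Lemma qbinom_rec k :
  (qbinom V k * qnat (\dim {:V} - k) = qbinom V k.+1 * qnat k.+1)%N.
Proof.
rewrite /qbinom -!sum_nat_const.
transitivity (\sum_(z in [set U : {vspace V} | \dim U == k]) \sum_(y | covers z
  y) 1)%N.
  apply: eq_bigr => z; rewrite inE => /eqP dz.
  by rewrite -dz -card_upf -sum1_card; apply: eq_bigl => y; rewrite inE.
rewrite (exchange_big_dep (mem [set U : {vspace V} | \dim U == k.+1])) /=;
  last first.
  by move=> z y; rewrite !inE => /eqP <- /andP[].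
apply: eq_bigr => y; rewrite inE => /eqP dy.
rewrite -dy -card_down -sum1_card; apply: eq_bigl => z.
by rewrite !inE /covers dy eqSS [k == _]eq_sym andbCA andbb.
Qed.

Lemma qbinom0 : qbinom V 0 = 1%N.
Proof.
rewrite /qbinom -(cards1 (0%VS : {vspace V})).
by apply: eq_card => U; rewrite !inE dimv_eq0.
Qed.

Lemma qbinomn : qbinom V (\dim {:V}) = 1%N.
Proof.
rewrite /qbinom -(cards1 (fullv : {vspace V})); apply: eq_card => U.
by rewrite !inE eqEdim subvf eqn_leq dimvS ?subvf.
Qed.

(** The recurrence [qbinom_rec] gives the same sequence when it is read upwards
    from dimension 0 and downwards from dimension n. *)
Lemma qbinom_sym k :
  (k <= \dim {:V})%N -> qbinom V (\dim {:V} - k) = qbinom V k.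
Proof.
elim: k => [|k IH] le_k; first by rewrite subn0 qbinomn qbinom0.
apply/eqP; rewrite -(eqn_pmul2r (qnat_gt0 (ltn0Sn k))) -qbinom_rec -IH 1?ltnW
  //.
have := qbinom_rec (\dim {:V} - k.+1).
by rewrite subKn // -subSn // subSS => ->.
Qed.

End Covers.

(** * Eigenvalues of the Casimir operator and continuants *)

Section QArith.
Variables (R : realFieldType) (q : R) (n : nat).
Hypothesis q_gt1 : 1 < q.

Lemma q1_neq0 : q - 1 != 0. Proof. by rewrite subr_eq0 gt_eqF. Qed.

Lemma qintE k : qint q k = (q ^+ k - 1) / (q - 1).
Proof. by rewrite subrX1 mulrAC divff ?mul1r // q1_neq0. Qed.

Lemma qint0 : qint q 0 = 0. Proof. exact: big_ord0. Qed.

Lemma qint_ge0 k : 0 <= qint q k.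
Proof.
by apply: sumr_ge0 => i _; rewrite exprn_ge0 // ltW // (lt_trans ltr01).
Qed.

Lemma qint_gt0 k : (0 < k)%N -> 0 < qint q k.
Proof.
by case: k => // k _; rewrite qintE divr_gt0 ?subr_gt0 // exprn_egt1.
Qed.

Definition casimir_eigen k : R := (q ^+ (n.+1 - k) + q ^+ k) / (q - 1) ^+ 2.
Local Notation kap := casimir_eigen.

(** The coefficient of the recurrence for F_q is a difference of eigenvalues. *)
Lemma casimir_eigen_sub k i : (k <= i.+1)%N -> (i + k <= n)%N ->
  kap k - kap i.+1 = q ^+ k * qint q (i.+1 - k) * qint q (n - k - i).
Proof.
move=> le_ki le_in; have [u def_i] : exists u, i.+1 = (k + u)%N
  by exists (i.+1 - k)%N; lia.
have [v def_n] : exists v, n = (i + k + v)%N by exists (n - (i + k))%N; lia.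
rewrite /kap !qintE def_i addKn.
have -> : (n.+1 - k = k + u + v)%N by lia.
have -> : (n.+1 - (k + u) = k + v)%N by lia.
have -> : (n - k - i = v)%N by lia.
rewrite !exprD; field; exact: q1_neq0.
Qed.

Lemma casimir_eigen_step i : (i <= n)%N ->
  kap i - kap i.+1 = qint q (n - i) - qint q i.
Proof.
move=> le_in; have [v def_n] : exists v, n = (i + v)%N by exists (n - i)%N; lia.
rewrite /kap !qintE.
have -> : (n.+1 - i = v.+1)%N by lia.
have -> : (n.+1 - i.+1 = v)%N by lia.
have -> : (n - i = v)%N by lia.
by rewrite !exprS; field; exact: q1_neq0.
Qed.

Lemma casimir_eigen_sym k : (k <= n.+1)%N -> kap (n.+1 - k) = kap k.
Proof. by move=> le_k; rewrite /kap subKn // addrC. Qed.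

Lemma casimir_eigen_le k : (k <= n.+1)%N -> kap k <= kap 0.
Proof.
move=> le_k; have [m def_n] : exists m, n.+1 = (m + k)%N
  by exists (n.+1 - k)%N; lia.
rewrite ler_pM2r ?invr_gt0 ?exprn_gt0 ?subr_gt0 // subn0 def_n addnK exprD.
by have := exprn_ege1 m (ltW q_gt1); have := exprn_ege1 k (ltW q_gt1); nra.
Qed.

Local Notation deg := (fun i => qint q i + qint q (n - i)).
Local Notation K := (continuant n kap deg).

Lemma continuant_horner i x : (i <= n)%N ->
  (K i).[x] = deg i * (K i.+1).[x] - (x - kap i.+1) * (K i.+2).[x].
Proof. by move=> le_in; rewrite continuantE // !hornerE. Qed.

Lemma top_sub i : (i <= n)%N -> kap 0 - kap i.+1 = qint q i.+1 * qint q (n - i).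
Proof.
by move=> le_in; rewrite casimir_eigen_sub ?addn0 // expr0 mul1r !subn0.
Qed.

(** At kappa_0 the recurrence collapses to first order, which is the reason for
    the product formula for F_q(n,0,1). *)
Lemma continuant_top i : (i <= n)%N ->
  (K i).[kap 0] = qint q i * (K i.+1).[kap 0].
Proof.
move=> le_in; have [m def_n] : exists m, n = (i + m)%N by exists (n - i)%N; lia.
elim: m i le_in def_n => [|m IH] i le_in def_n; rewrite continuant_horner //.
  have -> : i = n by lia.
  by rewrite continuant_over horner0 subnn qint0 addr0 mulr0 subr0.
rewrite top_sub // (IH i.+1); [ring | lia | lia].
Qed.

(** Positivity of the continuants at all the eigenvalues: kappa_0 is the largest
    one, and there the inequality is the equality [continuant_top]. *)
Lemma continuant_ge k i : (k <= n.+1)%N -> (i <= n)%N ->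
  0 < (K i.+1).[kap k] /\ qint q i * (K i.+1).[kap k] <= (K i).[kap k].
Proof.
move=> le_k le_in; have [m def_n] : exists m, n = (i + m)%N
  by exists (n - i)%N; lia.
elim: m i le_in def_n => [|m IH] i le_in def_n;
  rewrite (@continuant_horner i) //.
  have -> : i = n by lia.
  by rewrite continuant_over continuant_last !hornerE subnn qint0; split; lra.
have [K2_gt0 leK1] := IH i.+1 ltac:(lia) ltac:(lia).
have K1_gt0 : 0 < (K i.+1).[kap k].
  by apply: lt_le_trans leK1; rewrite mulr_gt0 // qint_gt0.
split=> //.
have e1 := top_sub le_in; have e2 := casimir_eigen_le le_k.
have e3 := ler_wpM2l (qint_ge0 (n - i)) leK1.
have e4 : (kap k - kap i.+1) * (K i.+2).[kap k]
    <= (kap 0 - kap i.+1) * (K i.+2).[kap k].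
  by rewrite ler_pM2r // lerB.
rewrite e1 in e4; lra.
Qed.

Lemma continuant_neq0 i k :
  (k <= n.+1)%N -> (i <= n)%N -> (K i.+1).[kap k] != 0.
Proof.
by move=> le_k le_in; rewrite gt_eqF //; case: (continuant_ge le_k le_in).
Qed.

(** The recurrence for F_q starts at j = n-k instead of j = n.  This is possible
    because its coefficient at j = n-k is zero, which splits off the factor
    K_(n-k+1). *)
Lemma continuant_Fpoly k j : (k.*2 <= n)%N -> (k <= j <= n - k + 1)%N ->
  (K j).[kap k] = Fpoly q n k j * (K (n - k).+1).[kap k].
Proof.
move=> le_k2 /andP[le_kj le_jn].
have sub0 : kap k - kap (n - k).+1 = 0.
  by rewrite casimir_eigen_sub; [rewrite subnn qint0 mulr0 | lia | lia].
suff [] : (K j).[kap k] = Fpoly q n k j * (K (n - k).+1).[kap k] /\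
  ((j <= n - k)%N ->
    (K j.+1).[kap k] = Fpoly q n k j.+1 * (K (n - k).+1).[kap k]) by [].
have [m def_j] : exists m, (n - k + 1 = j + m)%N by exists (n - k + 1 - j)%N;
  lia.
elim: m j le_kj le_jn def_j => [|m IH] j le_kj le_jn def_j.
  have -> : j = (n - k + 1)%N by lia.
  by rewrite Fpoly_last mul1r addn1; split=> //; rewrite ltnn.
have [eq1 eq2] := IH j.+1 ltac:(lia) ltac:(lia) ltac:(lia).
split=> //; rewrite (@continuant_horner j); last lia.
have [lt_j|ge_j] := ltnP j (n - k); last first.
  have -> : j = (n - k)%N by lia.
  rewrite Fpoly_penult sub0 mul0r subr0 subKn; last lia.
  by rewrite addrC.
rewrite Fpoly_step // !addn1 addn2 eq1 eq2 // casimir_eigen_sub;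
  [ring | lia | lia].
Qed.

End QArith.

(** * Spanning trees of the subspace graph *)

Lemma prod_pair_ends (R : comPzRingType) n (f : nat -> R) :
  \prod_(1 <= j < n.+1) f j =
    (\prod_(1 <= k < n./2.+1) (f k * f (n.+1 - k)%N))
    * (if odd n then f n./2.+1 else 1).
Proof.
have [m] := ubnP n; elim: m n f => // m IH [|[|n]] f lt_n.
- by rewrite !big_geq // mulr1.
- by rewrite big_nat1 big_geq // mul1r.
rewrite big_nat_recr // big_ltn // big_add1 /= IH; last by rewrite -ltnS ltnW.
rewrite [in RHS]big_ltn // [in RHS]big_add1 /= negbK subSS subn0.
under [in RHS]eq_bigr => k _ do rewrite subSS.
have -> : \prod_(1 <= k < n./2.+1) (f k.+1 * f (n.+2 - k)%N)
        = \prod_(1 <= k < n./2.+1) (f k.+1 * f (n.+1 - k).+1).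
  by apply: eq_big_nat => k /andP[_ le_k]; rewrite (@subSn k n.+1) //; lia.
by case: odd; ring.
Qed.

Section SubspaceLaplacian.
Variables (F : finFieldType) (V : vectType F).
Local Notation T := {vspace V}.
Local Notation q := (#|F|%:R : rat).
Local Notation n := (\dim {:V}).

Lemma card_subspaces : #|{: T}| = #|{: T}|.-1.+1.
Proof. by rewrite prednK //; apply/card_gt0P; exists 0%VS. Qed.

(** Polynomials are evaluated at matrices of visibly positive size, hence the
    successor in the index type. *)
Definition subspace_at (i : 'I_#|{: T}|.-1.+1) : T :=
  enum_val (cast_ord (esym card_subspaces) i).

Lemma subspace_at_bij : bijective subspace_at.
Proof.
exists (fun U => cast_ord card_subspaces (enum_rank U)) => x;
  rewrite /subspace_at.
  by rewrite enum_valK cast_ordKV.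
by rewrite cast_ordK enum_rankK.
Qed.
Local Notation h := subspace_at.

Lemma sum_subspace_at (R : nmodType) (G : T -> R) : \sum_i G (h i) = \sum_U G U.
Proof. by rewrite [RHS](reindex h) //; apply: onW_bij subspace_at_bij. Qed.

Definition up_mx : 'M[rat]_(#|{: T}|.-1.+1) :=
  \matrix_(i, j) (covers (h j) (h i))%:R.

Local Notation rk := (fun i => \dim (h i)).
Local Notation deg := (fun i => qint q i + qint q (n - i)).
Local Notation kap := (casimir_eigen q n).

Lemma qnat_qint k : (qnat F k)%:R = qint q k.
Proof. by rewrite natr_sum; apply: eq_bigr => i _; rewrite natrX. Qed.

Lemma dim_le (U : T) : (\dim U <= n)%N.
Proof. exact/dimvS/subvf. Qed.

Lemma q_gt1Q : 1 < q. Proof. by rewrite ltr1n q_gt1. Qed.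

Lemma DU_UD_up :
  up_mx^T * up_mx + rank_diag rk (fun i => kap i.+1)
    = up_mx * up_mx^T + rank_diag rk kap.
Proof.
apply/matrixP=> i j; rewrite !mxE.
have -> : \sum_k up_mx^T i k * up_mx k j
    = #|[set z | covers (h i) z & covers (h j) z]|%:R.
  under eq_bigr => k _ do rewrite !mxE -natrM mulnb.
  rewrite (sum_subspace_at (fun z => (covers (h i) z && covers (h j) z)%:R)).
  rewrite -natr_sum -big_mkcond sum1_card; congr _%:R.
  by apply: eq_card => z; rewrite inE.
have -> : \sum_k up_mx i k * up_mx^T k j
    = #|[set z | covers z (h i) & covers z (h j)]|%:R.
  under eq_bigr => k _ do rewrite !mxE -natrM mulnb.
  rewrite (sum_subspace_at (fun z => (covers z (h i) && covers z (h j))%:R)).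
  rewrite -natr_sum -big_mkcond sum1_card; congr _%:R.
  by apply: eq_card => z; rewrite inE.
have [<-|ij] := eqVneq i j; last first.
  by rewrite !mulr0n covers_both_up // (inj_eq (bij_inj subspace_at_bij)).
have idd (P : pred T) : [set z | P z & P z] = [set z | P z].
  by apply/setP=> z; rewrite !inE andbb.
rewrite !idd card_upf card_down !qnat_qint !mulr1n.
have := casimir_eigen_step q_gt1Q (dim_le (h i)); lra.
Qed.

Lemma subspace_graph_covers (x y : T) :
  @subspace_graph F V x y = covers x y || covers y x.
Proof.
rewrite /subspace_graph /covers.
case: (boolP (x <= y)%VS) => xy; case: (boolP (y <= x)%VS) => yx //=;
  try (have := dimvS xy); try (have := dimvS yx); lia.
Qed.

Lemma covers_dim (x y : T) : covers x y -> \dim y = (\dim x).+1.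
Proof. by case/andP=> _ /eqP. Qed.

(** Deleting the zero subspace is keeping the ranks at least 1. *)
Lemma reduced_laplacianE :
  reduced_laplacian rat (@subspace_graph F V) 0%VS h
    = tridiag_from rk up_mx up_mx^T deg 1.
Proof.
apply/matrixP=> i j.
have lapE x y : \sum_(z | @subspace_graph F V x z) parent_entry rat 0%VS z x y
    = deg (\dim x) * (x == y)%:R
      - ((y != 0%VS) && (covers x y || covers y x))%:R.
  rewrite sumrB; congr (_ - _).
    rewrite sumr_const -[LHS]mulr_natl; congr (_ * _);
      rewrite -!qnat_qint -natrD.
    rewrite -card_down -card_upf -cardsUI [X in (_ + X)%N](_ : _ = 0%N).
      rewrite addn0; congr _%:R; apply: eq_card => z.
      by rewrite -[LHS]/(@subspace_graph F V x z) subspace_graph_covers !inE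
        orbC.
    apply: eq_card0 => z; rewrite !inE; apply/negP=> /andP[/covers_dim dx
      /covers_dim].
    by lia.
  have [xy|xy] := boolP (@subspace_graph F V x y); last first.
    rewrite -subspace_graph_covers (negPf xy) andbF big1 // => z xz.
    by case: (eqVneq z y) xz xy => [-> ->|] //; rewrite andbF.
  rewrite (bigD1 y) //= eqxx -subspace_graph_covers xy big1 ?addr0 //
    => z /andP[_ /negPf->].
  by rewrite andbF.
rewrite /tridiag_from /rank_ge {1 2}/rank_diag -!mulmxE mul_diag_mx mul_mx_diag
  !mxE.
rewrite -!(inj_eq (bij_inj subspace_at_bij)) !lt0n !dimv_eq0.
have [hi|hi] := eqVneq (h i) 0%VS.
  rewrite (big_pred1 0%VS) => [|z]; last by rewrite /parent_choice hi eqxx.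
  rewrite /parent_entry eqxx hi subr0 /=; ring.
rewrite (eq_bigl (fun z => @subspace_graph F V (h i) z)) => [|z]; last first.
  by rewrite /parent_choice (negPf hi).
have excl (x y : T) : covers x y -> covers y x = false.
  by move=> /covers_dim dxy; apply/negbTE/negP=> /covers_dim; lia.
rewrite lapE; have [<-|ij] := eqVneq (h i) (h j).
  have -> : covers (h i) (h i) = false by apply/negbTE/negP=> /covers_dim; lia.
  by rewrite hi /= !mulr1n; ring.
case hj : (h j == 0%VS); case cij : (covers (h i) (h j));
  rewrite ?(excl _ _ cij) /=;
  case: (covers (h j) (h i)) => /=; rewrite ?mulr0n ?mulr1n; ring.
Qed.

Lemma level_qbinom k : level rk k = qbinom V k.
Proof.
rewrite /level /qbinom -(card_imset _ (bij_inj subspace_at_bij)).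
apply: eq_card => U; apply/imsetP/idP => [[i] | ]; rewrite !inE;
  first by move=> ? ->.
have [k' hK kK] := subspace_at_bij.
by move=> dU; exists (k' U); rewrite ?inE kK.
Qed.

Local Notation K := (continuant n kap deg).

Lemma nb_spanning_trees_continuant :
  (nb_spanning_trees (@subspace_graph F V))%:R
    = (K 1).[kap 0] * \prod_(1 <= j < n.+1)
        (K j).[kap j] ^ ((qbinom V j)%:Z - (qbinom V j.-1)%:Z).
Proof.
rewrite -(matrix_tree rat 0%VS subspace_at_bij (@subspace_graph_sym F V)
  (@subspace_graph_irr F V)).
rewrite reduced_laplacianE (det_tridiag_from1 (n := n) (kap := kap)).
- rewrite level_qbinom qbinom0 expr1; congr (_ * _).
  by apply: eq_bigr => j _; rewrite /level_diff !level_qbinom.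
- by move=> i; apply: dim_le.
- by move=> i j; rewrite mxE pnatr_eq0 eqb0 negbK => /covers_dim.
- by move=> i j; rewrite !mxE pnatr_eq0 eqb0 negbK => /covers_dim.
- exact: DU_UD_up.
move=> [|i] k le_i le_k _ //; apply: continuant_neq0; first exact: q_gt1Q.
  exact: leq_trans le_i.
exact: le_i.
Qed.
End SubspaceLaplacian.

Theorem theorem1p1 (q n : nat) (F : finFieldType) (V : vectType F)
    (hq : #|F| = q) (hn : \dim {:V} = n) :
  (nb_spanning_trees (@subspace_graph F V))%:R =
    Fpoly (q%:R : rat) n 0 1 *
    \prod_(1 <= k < n./2.+1)
       Fpoly (q%:R : rat) n k k
         ^ ((qbinom V k)%:Z - (qbinom V k.-1)%:Z)
  /\ Fpoly (q%:R : rat) n 0 1 = \prod_(1 <= i < n.+1) qint (q%:R : rat) i.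
Proof.
subst q n; set n := \dim {:V}.
have q1 := q_gt1Q F; set q := #|F|%:R in q1 *.
pose kap := casimir_eigen q n; pose deg i := qint q i + qint q (n - i).
pose K := continuant n kap deg.
have F01 : Fpoly q n 0 1 = (K 1).[kap 0].
  have /= := @continuant_Fpoly _ q n q1 0 1 (leq0n n);
    rewrite subn0 addn1 => -> //.
  by rewrite continuant_last hornerE mulr1.
split.
  rewrite nb_spanning_trees_continuant F01 -/n -/kap -/deg -/K; congr (_ * _).
  (* The factors k and n+1-k have the same eigenvalue and opposite exponents;
     the middle factor, for n odd, has exponent 0. *)
  rewrite prod_pair_ends -[RHS]mulr1; congr (_ * _).
    apply: eq_big_nat => k /andP[k_gt0 le_k].
    have le_kn : (k.*2 <= n)%N by lia.
    have -> : kap (n.+1 - k)%N = kap k by apply: casimir_eigen_sym; lia.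
    rewrite (_ : ((n.+1 - k).-1 = n - k)%N); last by lia.
    rewrite qbinom_sym; last by rewrite -/n; lia.
    rewrite (_ : (n.+1 - k = n - k.-1)%N); last by lia.
    rewrite qbinom_sym; last by rewrite -/n; lia.
    rewrite (_ : (n - k.-1 = (n - k).+1)%N); last by lia.
    rewrite (continuant_Fpoly q1) //; last by lia.
    rewrite expfzMl -mulrA -(opprB (qbinom V k)%:Z) -invr_expz divff ?mulr1 //.
    by rewrite expfz_neq0 // continuant_neq0 //; lia.
  case: ifP => // n_odd; set k := n./2.+1.
  rewrite (_ : _ - _ = 0) ?expr0z //; apply/eqP; rewrite subr_eq0.
  rewrite -(@qbinom_sym F V k.-1) -/n; last by rewrite /k; lia.
  by rewrite (_ : (n - k.-1 = k)%N) // /k; lia.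
rewrite F01.
suff top m : (m <= n)%N ->
    (K 1).[kap 0] = (\prod_(1 <= i < m.+1) qint q i) * (K m.+1).[kap 0].
  by rewrite (top n) // /K continuant_last hornerE mulr1.
elim: m => [|m IH] le_mn; first by rewrite big_geq // mul1r.
by rewrite IH 1?ltnW // [in RHS]big_nat_recr //= -mulrA -continuant_top.
Qed.
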